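(* Let $F\subset\mathbb{R}^d$ be a compact convex set with $0\in\operatorname{int}(F)$, let $m\ge 2$, $2\le k\le m$, and let $\Omega^1,\dots,\Omega^m\subset\mathbb{R}^d$ be nonempty compact sets. Then the following two statements are equivalent: (a) $S_k$ is compact. (b) $\displaystyle\min_{(x^1,\dots,x^k)\in\mathbb{R}^{dk}}f_k(x^1,\dots,x^k)<\min_{(x^1,\dots,x^{k-1})\in\mathbb{R}^{d(k-1)}}f_{k-1}(x^1,\dots,x^{k-1}).$
   Context: $\mathbb{R}^d$ ($d\ge1$) carries the Euclidean norm. For a nonempty set $\Omega\subset\mathbb{R}^d$ the minimal time function is $T_F(x,\Omega)=\inf\{t\ge 0\mid (x+tF)\cap\Omega\neq\emptyset\}$. For each integer $1\le\ell\le m$ and $x=(x^1,\dots,x^\ell)\in(\mathbb{R}^d)^\ell=\mathbb{R}^{d\ell}$, $f_\ell(x)=\sum_{i=1}^m\min_{1\le j\le \ell}T_F(x^j,\Omega^i)$, and $S_\ell=\{y\in\mathbb{R}^{d\ell}\mid f_\ell(y)=\min_{x\in\mathbb{R}^{d\ell}}f_\ell(x)\}$ is the set of global minimizers (the minima of $f_k$ and $f_{k-1}$ are attained). *)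

(* Defs.v *)
From HB Require Import structures.
From mathcomp Require Import all_boot all_order all_algebra.
From mathcomp Require Import all_classical all_reals all_analysis.

Set Implicit Arguments.
Unset Strict Implicit.
Unset Printing Implicit Defensive.

Import Order.TTheory GRing.Theory Num.Theory.
Import numFieldNormedType.Exports.

Local Open Scope classical_set_scope.
Local Open Scope ring_scope.

(* The topology of 'rV[R]_d and 'M[R]_(l, d) in the library comes from the sup
   norm, hence it is the Euclidean one; no other use of a norm is made. *)

(* [inf] is real-valued (and [inf set0 = 0]); the set below is nonempty as soon
   as [0] is interior to [F] and [Om] is nonempty, see [min_time_nonempty]. *)
Definition min_time (R : realType) (d : nat) (F : set 'rV[R]_d)
    (x : 'rV[R]_d) (Om : set 'rV[R]_d) : R :=
  inf [set t : R | 0 <= t /\ ([set x + t *: u | u in F] `&` Om) !=set0].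

Lemma min_time_nonempty (R : realType) (d : nat) (F Om : set 'rV[R]_d)
    (x : 'rV[R]_d) : interior F 0 -> Om !=set0 ->
  [set t : R | 0 <= t /\ ([set x + t *: u | u in F] `&` Om) !=set0] !=set0.
Proof.
move=> F0 [w Omw].
have cv : (fun s : R => s *: (w - x)) @ (0 : R)^'+ --> (0 : 'rV[R]_d).
  apply: cvg_at_right_filter; rewrite -[X in _ --> X](scale0r (w - x)).
  by apply: cvgZr_tmp; exact: cvg_id.
have /cv/= Fs : nbhs (0 : 'rV[R]_d) F by exact: F0.
have [s [s0 Fsw]] : exists s : R, 0 < s /\ F (s *: (w - x)).
  apply: (@filter_ex _ (0 : R)^'+); near=> s.
  by split; near: s; [exact: nbhs_right_gt | exact: Fs].
exists s^-1; split; first by rewrite invr_ge0 ltW.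
exists w; split=> //; exists (s *: (w - x)) => //.
by rewrite scalerA mulVf ?gt_eqF// scale1r addrC subrK.
Unshelve. all: by end_near. Qed.

(* The value on the empty family is junk; only l >= 1 is meant. *)
Definition fam_min (R : realType) (l : nat) : ('I_l -> R) -> R :=
  match l with
  | 0%N => fun=> 0
  | l'.+1 => fun g => \big[Num.min/g ord0]_(j < l'.+1) g j
  end.

(* A point [x] of (R^d)^l is an l x d matrix whose rows are the [x^j]. *)
Definition objective (R : realType) (d m : nat) (F : set 'rV[R]_d)
    (Om : 'I_m -> set 'rV[R]_d) (l : nat) (x : 'M[R]_(l, d)) : R :=
  \sum_(i < m) fam_min (fun j : 'I_l => min_time F (row j x) (Om i)).

Definition is_min_value (R : realType) (T : Type) (f : T -> R) (v : R) : Prop :=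
  range f v /\ lbound (range f) v.

Definition minimizers (R : realType) (T : Type) (f : T -> R) : set T :=
  [set y | is_min_value f (f y)].

(* Main.v *)
Require Import Defs.
From HB Require Import structures.
From mathcomp Require Import all_boot all_order all_algebra.
From mathcomp Require Import all_classical all_reals all_analysis.
Import Order.TTheory GRing.Theory Num.Theory.
Import numFieldNormedType.Exports.
Local Open Scope classical_set_scope.
Local Open Scope ring_scope.

(** The minimal time function is Lipschitz and tends to infinity at infinity.
If x^j is farther from every target than the value of f at x, then x^j is not
active in any of the minima and can be deleted without increasing f. Hence
below min f_(k-1) the sublevel sets of f_k are bounded, which gives both the
existence of minimizers (by induction on k) and (b) => (a). Conversely, if
adding a point does not lower the minimum, the additional point may be placed
anywhere, so the set of minimizers is unbounded. *)

(** * Sup norm and compactness for matrices *)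

Lemma mx_norm_leP {R : realType} {m n : nat} (x : 'M[R]_(m, n)) (c : R) :
  0 <= c -> (`|x| <= c) <-> (forall i j, `|x i j| <= c).
Proof.
move=> c0; rewrite {1}/Num.norm /= mx_normrE; split=> [xc i j|xc].
  by apply: le_trans xc; apply/bigmax_geP; right; exists (i, j).
by apply/bigmax_leP; split=> // -[i j] _; exact: xc.
Qed.

Lemma mx_entry_norm {R : realType} {m n : nat} (x : 'M[R]_(m, n)) i j :
  `|x i j| <= `|x|.
Proof. by have /mx_norm_leP := lexx `|x|; apply. Qed.

Lemma row_norm_le {R : realType} {m n : nat} (x : 'M[R]_(m, n)) i :
  `|row i x| <= `|x|.
Proof.
by apply/mx_norm_leP => // a b; rewrite mxE; exact: mx_entry_norm.
Qed.

Lemma dist_le_continuous {R : realType} {V W : normedModType R}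
    (f : V -> W) (C : R) :
  (forall x y, `|f x - f y| <= C * `|x - y|) -> continuous f.
Proof.
move=> fC x; apply/cvgrPdist_lt => e e0.
have C0 : 0 < `|C| + 1 by rewrite ltr_wpDl.
near=> y.
have xy : `|x - y| < e / (`|C| + 1).
  by near: y; apply: cvgr_dist_lt; rewrite ?divr_gt0.
apply: (@le_lt_trans _ _ ((`|C| + 1) * `|x - y|)); last first.
  by rewrite mulrC -ltr_pdivlMr.
rewrite (le_trans (fC x y))// ler_wpM2r// (le_trans (ler_norm C))//.
by rewrite lerDl.
Unshelve. all: by end_near. Qed.

(** [vec_mx] is an isometry for the sup norms, so Heine-Borel for row vectors transfers to
    matrices. *)
Lemma mx_bounded_closed_compact {R : realType} {m n : nat}
    (A : set 'M[R]_(m, n)) (c : R) :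
  (forall x, A x -> `|x| <= c) -> closed A -> compact A.
Proof.
move=> Ac Acl.
have vec_le (v : 'rV[R]_(m * n)) : `|vec_mx v| <= `|v|.
  by apply/mx_norm_leP => // i j; rewrite mxE; exact: mx_entry_norm.
have le_vec (v : 'rV[R]_(m * n)) : `|v| <= `|vec_mx v|.
  apply/mx_norm_leP => // a k; case/mxvec_indexP: k => i j.
  by rewrite ord1 -[v in leLHS]vec_mxK mxvecE mx_entry_norm.
have vec_cont : continuous (@vec_mx R m n).
  apply: (@dist_le_continuous _ _ _ _ 1) => v w.
  by rewrite -linearB mul1r; exact: vec_le.
have -> : A = (@vec_mx R m n) @` (@vec_mx R m n @^-1` A).
  apply/seteqP; split=> [x Ax|_ [v Av <-]//].
  by exists (mxvec x); rewrite /= mxvecK.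
apply: continuous_compact; first exact: continuous_subspaceT.
apply: bounded_closed_compact.
  exists c; split; first exact: num_real.
  by move=> M cM v /= /Ac vc; rewrite (le_trans (le_vec v))// (le_trans vc)// ltW.
by apply: closed_comp => // v _; exact: vec_cont.
Qed.

(** The point [c] is the convex combination of [a] and [b] with weight [s / (s + t)] on [a]; if
    [s + t = 0], both scalars vanish and any point of [F] serves. *)
Lemma convex_set_scaleD {R : realType} {d : nat} {F : set 'rV[R]_d}
    (a b : 'rV[R]_d) (s t : R) :
  convex_set F -> F a -> F b -> 0 <= s -> 0 <= t ->
  exists2 c, F c & s *: a + t *: b = (s + t) *: c.
Proof.
move=> cF Fa Fb s0 t0.
have [st0|st0] := eqVneq (s + t) 0.
  exists a => //; move/eqP: (st0); rewrite paddr_eq0// => /andP[/eqP-> /eqP->].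
  by rewrite addr0 !scale0r addr0.
have l0 : 0 <= s / (s + t) by rewrite divr_ge0// addr_ge0.
have l1 : s / (s + t) <= 1.
  by rewrite ler_pdivrMr ?mul1r ?lerDl// lt_neqAle eq_sym st0 addr_ge0.
have := cF a b (Itv01 l0 l1) (mem_set Fa) (mem_set Fb) => /set_mem Fc.
exists (conv (Itv01 l0 l1) (a : convex_lmodType _) (b : convex_lmodType _)) => //.
rewrite /conv /= scalerDr !scalerA.
have -> : (s + t) * (s / (s + t)) = s by rewrite mulrC divfK.
congr (_ + _ *: _).
by rewrite /unstable.onem mulrBr mulr1 mulrC divfK// addrAC subrr add0r.
Qed.

(** * The minimal time function *)

Definition hit_times {R : realType} {d : nat} (F : set 'rV[R]_d)
    (x : 'rV[R]_d) (Om : set 'rV[R]_d) : set R :=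
  [set t : R | 0 <= t /\ ([set x + t *: u | u in F] `&` Om) !=set0].

Section min_time_theory.
Context {R : realType} {d : nat} {F : set 'rV[R]_d}.

Lemma min_time_ge0 (x : 'rV[R]_d) (Om : set 'rV[R]_d) : 0 <= min_time F x Om.
Proof.
rewrite /min_time; set S := (X in inf X).
(* The default [inf set0 = 0] settles the case without hitting times. *)
have [->|/set0P S0] := eqVneq S set0; first by rewrite inf0.
by apply: lb_le_inf => // t [].
Qed.

Lemma min_time_le (x : 'rV[R]_d) (Om : set 'rV[R]_d) (t : R) :
  hit_times F x Om t -> min_time F x Om <= t.
Proof. by move=> xt; apply: ge_inf => //; exists 0 => s []. Qed.

(** Since [F] contains a ball around 0, moving from [x] to [y] takes a time proportional to their
    distance; convexity merges this move with one from [y] to [Om]. The constant depends on [F]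
    only, hence serves all targets at once. *)
Lemma min_time_lipschitz : interior F 0 -> convex_set F -> exists2 C : R, 0 <= C &
  forall Om x y, Om !=set0 ->
    min_time F x Om <= min_time F y Om + C * `|x - y|.
Proof.
move=> F0 cF; have /nbhs_ballP[r /= r0 rF] := F0.
(* The factor 2 gives [s^-1 *: (y - x)] the norm [r / 2], strictly inside the open ball of radius
   [r]. *)
exists (2 / r); first by rewrite divr_ge0// ltW.
move=> Om x y Om0; rewrite -lerBlDr; apply: lb_le_inf.
  exact: min_time_nonempty.
move=> t yt; rewrite lerBlDr; have [->|xy] := eqVneq x y.
  by rewrite subrr normr0 mulr0 addr0; exact: min_time_le.
have [t0 [w [[u Fu <-] Omw]]] := yt.
set s := 2 / r * `|x - y|.
have s0 : 0 < s by rewrite mulr_gt0 ?divr_gt0 ?normr_gt0 ?subr_eq0.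
have Fv : F (s^-1 *: (y - x)).
  apply: rF; rewrite -ball_normE /= sub0r normrN normrZ gtr0_norm ?invr_gt0//.
  rewrite distrC /s invfM invf_div -mulrA mulVf ?normr_eq0 ?subr_eq0// mulr1.
  by rewrite ltr_pdivrMr// mulr_natr mulr2n ltrDl.
have [c Fc E] := convex_set_scaleD _ _ _ _ cF Fu Fv t0 (ltW s0).
apply: min_time_le; split; first by rewrite addr_ge0// ltW.
exists (y + t *: u); split=> //; exists c => //.
rewrite -E scalerA divff ?gt_eqF// scale1r.
by rewrite addrCA [x + _]addrC subrK addrC.
Qed.

(** A point hitting [Om] at time [t] equals [w - t *: u] with [w] in [Om] and [u] in [F], both
    bounded. A time within 1 of the infimum is used, whence [c + 1]. *)
Lemma min_time_coercive (Om : set 'rV[R]_d) (c : R) :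
  interior F 0 -> compact F -> compact Om -> Om !=set0 ->
  exists B : R, forall x, min_time F x Om <= c -> `|x| <= B.
Proof.
move=> F0 /compact_bounded[M [_ FM]] /compact_bounded[N [_ OmN]] Om0.
have {}FM u : F u -> `|u| <= `|M| + 1.
  by apply: FM; rewrite (le_lt_trans (ler_norm M))// ltrDl.
have {}OmN u : Om u -> `|u| <= `|N| + 1.
  by apply: OmN; rewrite (le_lt_trans (ler_norm N))// ltrDl.
exists ((`|N| + 1) + (c + 1) * (`|M| + 1)) => x xc.
have [] := @inf_adherent R (hit_times F x Om) 1 ltr01.
  by split; [exact: min_time_nonempty | exists 0 => s []].
move=> t [t0 [w [[u Fu <-] Omw]]] tc.
have {}tc : t <= c + 1 by rewrite (le_trans (ltW tc))// lerD2r.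
rewrite -[x](addrK (t *: u)) (le_trans (ler_normB _ _))//.
rewrite lerD ?OmN// normrZ ger0_norm//.
by apply: ler_pM => //; exact: FM.
Qed.
End min_time_theory.

(** * Minima of finite families *)

Lemma fam_min_le {R : realType} {l : nat} (g : 'I_l -> R) j : fam_min g <= g j.
Proof. by case: l g j => [g []//|l g j] /=; exact: bigmin_le. Qed.

Lemma fam_minP {R : realType} {l : nat} (g : 'I_l.+1 -> R) :
  exists j, fam_min g = g j.
Proof.
rewrite /=; elim/big_ind: _ => [|a b [i ->] [j ->]|j _]; [by exists ord0| |by exists j].
by case: (leP (g i) (g j)) => _; [exists i | exists j].
Qed.

Lemma fam_min_ge0 {R : realType} {l : nat} (g : 'I_l -> R) :
  (forall j, 0 <= g j) -> 0 <= fam_min g.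
Proof. by case: l g => [//|l] g g0; have [j ->] := fam_minP g. Qed.

Lemma fam_min_leD {R : realType} {l : nat} (g h : 'I_l -> R) (e : R) :
  0 <= e -> (forall j, g j <= h j + e) -> fam_min g <= fam_min h + e.
Proof.
case: l g h => [|l] g h e0 gh; first by rewrite add0r.
by have [j ->] := fam_minP h; apply: le_trans (gh j); exact: fam_min_le.
Qed.

(** * The objective: adding and deleting points, compact sublevel sets, minimizers *)

Section objective_theory.
Context {R : realType} {d m : nat} {F : set 'rV[R]_d}.
Context {Om : 'I_m -> set 'rV[R]_d}.
Local Notation f := (@objective R d m F Om _).

Lemma fam_min_le_objective {l : nat} (x : 'M[R]_(l, d)) i :
  fam_min (fun j => min_time F (row j x) (Om i)) <= f x.
Proof.
rewrite /objective (bigD1 i)//= lerDl; apply: sumr_ge0 => i' _.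
by apply: fam_min_ge0 => j; exact: min_time_ge0.
Qed.

(** Each minimum runs over a larger family. As [y] has at least one row, the default value 0 of the
    empty family does not interfere. *)
Lemma objective_col_mx {l : nat} (r : 'rV[R]_d) (y : 'M[R]_(l.+1, d)) :
  f (col_mx r y) <= f y.
Proof.
apply: ler_sum => i _.
have [j ->] := fam_minP (fun j => min_time F (row j y) (Om i)).
have <- : row (rshift 1 j) (col_mx r y) = row j y by exact: rowKd.
exact: (fam_min_le (fun j' : 'I_l.+2 => _)).
Qed.

(** The summands are nonnegative, so each minimum is at most [f x] and is attained at a row other
    than [j], which survives the deletion. *)
Lemma objective_row' {l : nat} (x : 'M[R]_(l.+2, d)) j :
  (forall i, f x < min_time F (row j x) (Om i)) -> f (row' j x) <= f x.
Proof.
move=> far; apply: ler_sum => i _.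
have := fam_min_le_objective x i.
have [j0 ->] := fam_minP (fun j => min_time F (row j x) (Om i)).
have [j1 -> _|-> /le_lt_trans/(_ (far i))] := unliftP j j0; last by rewrite ltxx.
have -> : row (lift j j1) x = row j1 (row' j x).
  by apply/rowP => a; rewrite !mxE.
exact: fam_min_le.
Qed.

Hypotheses (F_compact : compact F) (F_convex : convex_set F).
Hypotheses (F_int0 : interior F 0).
Hypotheses (Om_nonempty : forall i, Om i !=set0).
Hypotheses (Om_compact : forall i, compact (Om i)).

Lemma objective_continuous {l : nat} : continuous (f : 'M[R]_(l, d) -> R).
Proof.
have [C C0 HC] := min_time_lipschitz F_int0 F_convex.
have lip (x y : 'M[R]_(l, d)) : f x <= f y + (C *+ m) * `|x - y|.
  rewrite mulrnAl -[m in _ *+ m]card_ord -sumr_const -big_split /=.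
  apply: ler_sum => i _; apply: fam_min_leD => [|j]; first by rewrite mulr_ge0.
  apply: le_trans (HC _ _ (row j y) (Om_nonempty i)) _.
  by rewrite lerD2l ler_wpM2l// -linearB row_norm_le.
apply: (@dist_le_continuous _ _ _ _ (C *+ m)) => x y.
by rewrite ler_distl lerBlDr lip {1}distrC lip.
Qed.

(** By coercivity a row close to target [i] is bounded by [B i]; the largest [B i] bounds all
    entries, and continuity gives closedness. *)
Lemma objective_sublevel_compact {l : nat} (c : R) :
  (forall x : 'M[R]_(l, d), f x <= c ->
     forall j, exists i, min_time F (row j x) (Om i) <= c) ->
  compact [set x : 'M[R]_(l, d) | f x <= c].
Proof.
move=> near_rows.
have /choice[B xB] i := min_time_coercive (Om i) c F_int0 F_compact
  (Om_compact i) (Om_nonempty i).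
apply: (@mx_bounded_closed_compact _ _ _ _ (\big[Num.max/0]_i B i)).
  move=> x /near_rows xc; apply/mx_norm_leP => [|j a].
    exact: bigmax_ge_id.
  have [i /xB jB] := xc j.
  rewrite (_ : x j a = row j x 0 a); last by rewrite mxE.
  by rewrite (le_trans (mx_entry_norm _ _ _))// (le_trans jB)// le_bigmax.
have -> : [set x : 'M[R]_(l, d) | f x <= c] = f @^-1` [set t | t <= c] by [].
by apply: closed_comp => [x _|]; [exact: objective_continuous | exact: closed_le].
Qed.

(* A row that is far from every target serves none of them, so deleting it
   would give a value [<= c] with one point less. *)
Lemma objective_sublevel_compactS {l : nat} (c v : R) :
  lbound (range (f : 'M[R]_(l.+1, d) -> R)) v -> c < v ->
  compact [set x : 'M[R]_(l.+2, d) | f x <= c].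
Proof.
move=> lbv cv; apply: objective_sublevel_compact => x xc j.
apply/not_existsP => far.
have /objective_row' : forall i, f x < min_time F (row j x) (Om i).
  by move=> i; rewrite (le_lt_trans xc)// ltNge; apply/negP/far.
move=> /le_trans/(_ xc) /le_lt_trans/(_ cv).
by rewrite ltNge lbv//; exists (row' j x).
Qed.

Lemma sublevel_compact_min {l : nat} (x0 : 'M[R]_(l, d)) :
  compact [set x : 'M[R]_(l, d) | f x <= f x0] ->
  exists v, is_min_value (f : 'M[R]_(l, d) -> R) v.
Proof.
move=> cpt.
have [||z /set_mem /= zx0 zmin] :=
    @compact_EVT_min _ R (f : 'M[R]_(l, d) -> R) _ _ cpt.
- by exists x0 => /=.
- exact/continuous_subspaceT/objective_continuous.
exists (f z); split; first by exists z.
move=> _ [x _ <-]; have [xx0|/ltW x0x] := leP (f x) (f x0).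
  by apply: zmin; exact: mem_set.
exact: le_trans x0x.
Qed.

Lemma objective_min_exists (l : nat) : (0 < m)%N ->
  exists v, is_min_value (f : 'M[R]_(l.+1, d) -> R) v.
Proof.
move=> m0; elim: l => [|l [v [[y _ yv] lbv]]].
  (* With a single point each minimum is its one minimal time, hence at most [f x]. *)
  apply: (sublevel_compact_min 0); apply: objective_sublevel_compact => x xc j.
  exists (Ordinal m0); apply: le_trans xc.
  have := fam_min_le_objective x (Ordinal m0).
  have [j0 ->] := fam_minP (fun j0 => min_time F (row j0 x) (Om (Ordinal m0))).
  by rewrite !ord1.
(* Either one more point beats [v] and a sublevel set below [v] is compact, or [v] remains the
   minimum, attained by padding [y] with any row. *)
have [[x xv]|no_less] := pselect (exists x : 'M[R]_(l.+2, d), f x < v).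
  by apply: (sublevel_compact_min x); exact: objective_sublevel_compactS xv.
have vle (x : 'M[R]_(l.+2, d)) : v <= f x.
  by rewrite leNgt; apply/negP => xv; apply: no_less; exists x.
exists v; split; last by move=> _ [x _ <-].
exists (col_mx (0 : 'rV_d) y) => //.
by apply/le_anti; rewrite vle -yv objective_col_mx.
Qed.

End objective_theory.

Theorem theorem4p5 (R : realType) (d : nat) (hd : (1 <= d)%N)
    (F : set 'rV[R]_d) (F_compact : compact F) (F_convex : convex_set F)
    (F_int0 : interior F 0)
    (m : nat) (hm : (2 <= m)%N) (k : nat) (hk : (2 <= k <= m)%N)
    (Om : 'I_m -> set 'rV[R]_d)
    (Om_nonempty : forall i, Om i !=set0)
    (Om_compact : forall i, compact (Om i)) :
  compact (minimizers (@objective R d m F Om k)) <->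
  (exists vk vk1 : R,
     [/\ is_min_value (@objective R d m F Om k) vk,
         is_min_value (@objective R d m F Om k.-1) vk1
       & vk < vk1]).
Proof.
case: k hk => [//|[//|l]] _ /=.
have m0 : (0 < m)%N := ltnW hm.
split=> [cpt|[v [v1 [[[x0 _ <-] lbv] [_ lbv1] vv1]]]]; last first.
  (* The minimizers form the sublevel set at the minimal value. *)
  have -> : minimizers (@objective R d m F Om l.+2) =
      [set x | objective F Om x <= objective F Om x0].
    apply/seteqP; split=> [y [_ lby]|y /= yx0]; first by apply: lby; exists x0.
    by split=> [|t /lbv/(le_trans yx0)//]; exists y.
  exact: objective_sublevel_compactS lbv1 vv1.
have [v vmin] := objective_min_exists F_compact F_convex F_int0 Om_nonempty
  Om_compact l.+1 m0.
have [v1 v1min] := objective_min_exists F_compact F_convex F_int0 Om_nonempty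
  Om_compact l m0.
exists v, v1; split=> //; rewrite ltNge; apply/negP => v1v.
have [M [_ minM]] := compact_bounded cpt.
have [[y _ yv1] _] := v1min.
(* Padding [y] with any row gives a minimizer; the entries [|M| + 2] violate the bound [|M| + 1]
   that compactness imposes on minimizers. *)
pose r : 'rV[R]_d := const_mx (`|M| + 2).
have rmin : minimizers (@objective R d m F Om l.+2) (col_mx r y).
  split; first by exists (col_mx r y).
  move=> t /(proj2 vmin); apply: le_trans.
  by rewrite (le_trans _ v1v)// -yv1 objective_col_mx.
have M1 : M < `|M| + 1 by rewrite (le_lt_trans (ler_norm M))// ltrDl.
have /= rM := minM _ M1 _ rmin.
have := le_trans (mx_entry_norm (col_mx r y) (lshift l.+1 0) (Ordinal hd)) rM.
by rewrite col_mxEu mxE ger0_norm ?addr_ge0// lerD2l leNgt ltr1n.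
Qed.
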